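(* Let $x,\hat x\ge 0$ be two feasible pre-commitment setpoints, with corresponding optimal recourse dispatches $X(\omega)$ and $\hat X(\omega)$, i.e. $X(\omega)$ (resp. $\hat X(\omega)$) is part of an optimal solution of the real-time recourse problem in scenario $\omega$ with setpoint $x$ (resp. $\hat x$). Then the corresponding optimal second-stage nonanticipativity dual multipliers $\rho(\omega),\hat\rho(\omega)$ satisfy $$\mathbb{P}\Big(\big\langle x-\hat x,\ \rho(\omega)-\hat\rho(\omega)\big\rangle\ge 0\Big)=1 .$$
   Context: Setting (stochastic dispatch of an electricity market). $\Omega$ is a finite sample space with probability $\mathbb{P}$; $\mathcal{N}$ is the set of nodes of a network; $\mathcal{T}(n)$ is the set of generators located at node $n$. $\mathcal{F}$ is a closed, convex, non-empty set of flow vectors (obeying thermal limits, line capacities and DC load-flow constraints). $\tau_n(F)$ is the net energy injected from the grid into node $n$ under flow $F$, a linear function of $F$. For generator $i$: $c_i$ is the marginal generation cost, $G_i(\omega)\ge0$ the capacity in scenario $\omega$, and $r_{u,i},r_{v,i}\ge 0$ the marginal costs of upward and downward deviation (positive for some generator). $D_n(\omega)$ is the inelastic demand at node $n$. Real-time recourse problem in scenario $\omega$ for a given pre-commitment setpoint $x$ (one component $x_i$ per generator): $$\min_{X,U,V,F}\ c^\top X+r_u^\top U+r_v^\top V$$ subject to $\sum_{i\in\mathcal{T}(n)}X_i+\tau_n(F)\ge D_n(\omega)$ for all $n\in\mathcal{N}$ (multiplier $\lambda_n(\omega)\ge0$), $X-U+V=x$ (nonanticipativity multiplier $\rho(\omega)$),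 $F\in\mathcal{F}$, $0\le X\le G(\omega)$, $U,V\ge 0$. A setpoint $x\geq 0$ is feasible if this problem is feasible in every scenario. Sign convention: the Lagrangian contains the terms $\lambda_n(\omega)\big(D_n(\omega)-\sum_{i\in\mathcal{T}(n)}X_i-\tau_n(F)\big)$ and $\langle\rho(\omega),x-X+U-V\rangle$, so that $\rho(\omega)$ is a subgradient, with respect to $x$, of the optimal value of the recourse problem in scenario $\omega$. *)

(* Defs.v *)
From HB Require Import structures.
From mathcomp Require Import all_boot all_order all_algebra.
From mathcomp Require Import all_classical all_reals all_analysis.

Set Implicit Arguments.
Unset Strict Implicit.
Unset Printing Implicit Defensive.

Import Order.TTheory GRing.Theory Num.Theory.
Import numFieldNormedType.Exports.

Local Open Scope classical_set_scope.
Local Open Scope ring_scope.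

Definition inner (R : realType) (I : finType) (a b : {ffun I -> R}) : R :=
  \sum_(i : I) a i * b i.

Definition nonneg (R : realType) (I : finType) (a : {ffun I -> R}) : Prop :=
  forall i, 0 <= a i.

Record market (R : realType) (Omega : Type) (Node Gen : finType) (m : nat) :=
  Market {
    location : Gen -> Node;
    (* flows satisfying the thermal, line-capacity and DC load-flow limits *)
    flows : set 'rV[R]_m;
    flows_closed : closed flows;
    flows_convex : convex_set flows;
    flows_nonempty : flows !=set0;
    (* net energy injected from the grid into a node *)
    net_injection : Node -> {linear 'rV[R]_m -> R^o};
    gen_cost : {ffun Gen -> R};
    capacity : Omega -> {ffun Gen -> R};
    capacity_ge0 : forall w, nonneg (capacity w);
    up_cost : {ffun Gen -> R};
    up_cost_ge0 : nonneg up_cost;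
    down_cost : {ffun Gen -> R};
    down_cost_ge0 : nonneg down_cost;
    deviation_cost_gt0 : exists i, 0 < up_cost i \/ 0 < down_cost i;
    demand : Omega -> {ffun Node -> R} }.

(* A decision (X, U, V, F) of the recourse problem. *)
Record dispatch (R : realType) (Gen : finType) (m : nat) := Dispatch {
  output : {ffun Gen -> R};
  up_dev : {ffun Gen -> R};
  down_dev : {ffun Gen -> R};
  flow : 'rV[R]_m }.

Section Recourse.
Context (R : realType) (Omega : Type) (Node Gen : finType) (m : nat).
Variable M : market R Omega Node Gen m.
Implicit Types (w : Omega) (n : Node) (x rho : {ffun Gen -> R}).
Implicit Types (lam : {ffun Node -> R}) (z : dispatch R Gen m).

Definition generators_at n : {set Gen} := [set i | location M i == n].

Definition supply n z : R :=
  \sum_(i in generators_at n) output z i + net_injection M n (flow z).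

Definition recourse_cost z : R :=
  inner (gen_cost M) (output z) + inner (up_cost M) (up_dev z)
  + inner (down_cost M) (down_dev z).

(* The constraints that are not dualized in the Lagrangian. *)
Definition undualized w z : Prop :=
  [/\ flow z \in flows M,
      forall i, 0 <= output z i <= capacity M w i,
      nonneg (up_dev z)
    & nonneg (down_dev z)].

Definition recourse_feasible w x z : Prop :=
  [/\ forall n, demand M w n <= supply n z,
      output z - up_dev z + down_dev z = x
    & undualized w z].

Definition recourse_optimal w x z : Prop :=
  recourse_feasible w x z /\
  forall z', recourse_feasible w x z' -> recourse_cost z <= recourse_cost z'.

Definition optimal_output w x (X : {ffun Gen -> R}) : Prop :=
  exists2 z, recourse_optimal w x z & output z = X.

Definition feasible_setpoint x : Prop :=
  nonneg x /\ forall w, exists z, recourse_feasible w x z.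

Definition lagrangian w x lam rho z : R :=
  recourse_cost z
  + \sum_(n : Node) lam n * (demand M w n - supply n z)
  + inner rho (x - output z + up_dev z - down_dev z).

(* Extended-real valued: the flow set may be unbounded. *)
Definition dual_function w x lam rho : \bar R :=
  ereal_inf [set (lagrangian w x lam rho z)%:E | z in undualized w].

Definition dual_optimal w x lam rho : Prop :=
  nonneg lam /\
  forall lam' rho', nonneg lam' ->
    (dual_function w x lam' rho' <= dual_function w x lam rho)%E.

(* The rho-component of a solution (lam, rho) of the Lagrangian dual. *)
Definition optimal_nonanticipativity_multiplier w x rho : Prop :=
  exists lam, dual_optimal w x lam rho.

End Recourse.

(* Main.v *)
Require Import Defs.
From mathcomp Require Import all_boot all_order all_algebra.
From mathcomp Require Import all_classical all_reals all_analysis.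
From mathcomp Require Import ring lra.
Import Order.TTheory GRing.Theory Num.Theory.
Local Open Scope classical_set_scope.
Local Open Scope ring_scope.

(** The inequality is the monotonicity of the subdifferential of a convex
    function, and it can be read off the dual problem alone.  In a fixed scenario
    the setpoint [x] enters the Lagrangian only through the affine term
    [inner rho x], so the dual function at [x] is [q (lam, rho) + inner rho x]
    with [q] independent of [x] ([dual_function_shift]).  If [(lam, rho)]
    maximizes this at [x] and [(lam', rho')] maximizes it at [y], comparing each
    maximizer with the other one gives
    [[
      q (lam, rho) + inner rho x >= q (lam', rho') + inner rho' x
      q (lam', rho') + inner rho' y >= q (lam, rho) + inner rho y
    ]]
    whose sum is [0 <= inner (x - y) (rho - rho')].

    The sum may be cancelled only if [q] is finite at both maximizers.  It is not
    [+oo] because the undualized constraints can be satisfied.  It is not [-oo]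
    because the optimal dual value is at least the one at [lam = 0, rho = 0],
    where the Lagrangian is the recourse cost: this is bounded below since
    outputs range between zero and capacity, deviation costs are nonnegative and
    flows are free of charge ([dual_function00_gtNy]).

    This holds in every scenario, so the event is the whole sample space. *)

Section InnerProduct.
Variables (R : realType) (I : finType).
Implicit Types a b c : {ffun I -> R}.

Lemma innerDr a b c : inner a (b + c) = inner a b + inner a c.
Proof.
by rewrite /inner -big_split; apply: eq_bigr => i _; rewrite ffunE mulrDr.
Qed.

Lemma inner_cross a b a' b' :
  inner (a - a') (b - b')
  = - (inner b (a' - a) + inner b' (a - a')).
Proof.
rewrite /inner -big_split -sumrN; apply: eq_bigr => i _ /=.
by rewrite !ffunE; ring.
Qed.

Lemma inner0l a : inner 0 a = 0.
Proof. by rewrite /inner big1 // => i _; rewrite ffunE mul0r. Qed.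

Lemma inner_ge0 a b : nonneg a -> nonneg b -> 0 <= inner a b.
Proof. by move=> a0 b0; apply: sumr_ge0 => i _; exact: mulr_ge0. Qed.

Lemma inner_box_ge a b c :
  (forall i, 0 <= b i <= c i) -> - \sum_i `|a i| * c i <= inner a b.
Proof.
move=> bc; rewrite -sumrN; apply: ler_sum => i _.
have /andP[b0 bci] := bc i.
have : - (`|a i| * b i) <= a i * b i.
  by rewrite -mulNr ler_wpM2r // lerNl -normrN ler_norm.
apply: le_trans; by rewrite lerN2 ler_wpM2l.
Qed.

End InnerProduct.

Section DualFunction.
Variables (R : realType) (Omega : Type) (Node Gen : finType) (m : nat).
Variables (M : market R Omega Node Gen m) (w : Omega).
Implicit Types (x y rho : {ffun Gen -> R}) (lam : {ffun Node -> R}).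

Lemma lagrangian_shift x y lam rho z :
  lagrangian M w y lam rho z = lagrangian M w x lam rho z + inner rho (y - x).
Proof.
rewrite /lagrangian -[RHS]addrA -innerDr; congr (_ + inner _ _).
by apply/ffunP => i; rewrite !ffunE; ring.
Qed.

(** Equality follows by exchanging [x] and [y], so the dual function at [y] is
    finite exactly when the one at [x] is. *)
Lemma dual_function_shift x y lam rho :
  (dual_function M w x lam rho + (inner rho (y - x))%:E
   <= dual_function M w y lam rho)%E.
Proof.
apply: le_ereal_inf_tmp => _ [z zM <-].
rewrite (lagrangian_shift x y) EFinD leeD2r //.
by apply: ereal_inf_lbound; exists z.
Qed.

Lemma dual_function_lty x y lam rho z :
  recourse_feasible M w y z -> (dual_function M w x lam rho < +oo)%E.
Proof.
move=> [_ _ zM]; apply: (@le_lt_trans _ _ (lagrangian M w x lam rho z)%:E).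
  by apply: ereal_inf_lbound; exists z.
exact: ltry.
Qed.

(** With all multipliers zero the demand constraint disappears, so an unbounded
    set of flows cannot drive the Lagrangian to [-oo]. *)
Lemma dual_function00_gtNy x : (-oo < dual_function M w x 0%R 0%R)%E.
Proof.
set K := - \sum_i `|gen_cost M i| * capacity M w i.
apply: (@lt_le_trans _ _ K%:E); first exact: ltNyr.
apply: le_ereal_inf_tmp => _ [z [_ zX zU zV] <-]; rewrite lee_fin.
rewrite /lagrangian inner0l big1 => [|n _]; last by rewrite ffunE mul0r.
rewrite !addr0 /recourse_cost.
have KX : K <= inner (gen_cost M) (output z) by exact: inner_box_ge.
have := inner_ge0 _ _ _ _ (up_cost_ge0 M) zU.
have := inner_ge0 _ _ _ _ (down_cost_ge0 M) zV.
by lra.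
Qed.

Lemma dual_optimal_fin_num x y lam rho z :
  recourse_feasible M w y z -> dual_optimal M w x lam rho ->
  dual_function M w x lam rho \is a fin_num.
Proof.
move=> zfeas [_ opt]; rewrite fin_numElt (dual_function_lty _ _ _ _ _ zfeas).
rewrite andbT; apply: lt_le_trans (dual_function00_gtNy x) (opt _ _ _).
by move=> n; rewrite ffunE.
Qed.

(** Each optimal pair is a competitor in the dual problem of the other setpoint.
    Adding the two comparisons cancels the demand multipliers together with the
    dual values; this is where their finiteness matters, since two dual values
    equal to [-oo] would compare without constraining [rho] and [rho']. *)
Lemma optimal_multiplier_monotone x y rho rho' z :
  recourse_feasible M w x z ->
  optimal_nonanticipativity_multiplier M w x rho ->
  optimal_nonanticipativity_multiplier M w y rho' ->
  0 <= inner (x - y) (rho - rho').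
Proof.
move=> zfeas [lam opt] [lam' opt'].
have fin := dual_optimal_fin_num _ _ _ _ _ zfeas opt.
have fin' := dual_optimal_fin_num _ _ _ _ _ zfeas opt'.
have [lam_ge0 max] := opt; have [lam'_ge0 max'] := opt'.
have := le_trans (dual_function_shift y x lam' rho') (max _ _ lam'_ge0).
have := le_trans (dual_function_shift x y lam rho) (max' _ _ lam_ge0).
rewrite -(fineK fin) -(fineK fin') -!EFinD !lee_fin inner_cross.
by lra.
Qed.

End DualFunction.

Theorem proposition1 (R : realType) (d : measure_display)
    (Omega : measurableType d)
    (Omega_finite : finite_set [set: Omega])
    (Omega_discrete : forall A : set Omega, measurable A)
    (P : probability Omega R)
    (Node Gen : finType) (m : nat) (M : market R Omega Node Gen m)
    (x xhat : {ffun Gen -> R})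
    (x_feasible : feasible_setpoint M x)
    (xhat_feasible : feasible_setpoint M xhat)
    (X Xhat : Omega -> {ffun Gen -> R})
    (X_optimal : forall w, optimal_output M w x (X w))
    (Xhat_optimal : forall w, optimal_output M w xhat (Xhat w))
    (rho rhohat : Omega -> {ffun Gen -> R})
    (rho_optimal :
       forall w, optimal_nonanticipativity_multiplier M w x (rho w))
    (rhohat_optimal :
       forall w, optimal_nonanticipativity_multiplier M w xhat (rhohat w)) :
  P [set w | 0 <= inner (x - xhat) (rho w - rhohat w)] = 1%:E.
Proof.
rewrite -(probability_setT P); congr (P _); apply/seteqP; split => // w _ /=.
have [_ /(_ w) [z zfeas]] := x_feasible.
exact: optimal_multiplier_monotone zfeas (rho_optimal w) (rhohat_optimal w).
Qed.
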